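(* Let $k\geq 1$ be an integer and let $p$ be a real number with $0<p\leq \frac{1}{2^{k+1}}$. Then the capacity $C_{k,p}$ of the $(0,k,p)$-RLL semiconstrained system satisfies $$C_{k,p}\leq 1-\frac{1}{3-2^{-k+1}}\left(\frac{\log_2 e}{2^{k+1}}+p(k+1)-p\log_2\frac{e}{p}\right).$$
   Context: For finite words $\tau,\omega$ over $\{0,1\}$ with $|\tau|\leq|\omega|$, $T(\tau,\omega)=\frac{1}{|\omega|-|\tau|+1}\,\#\{0\leq i\leq |\omega|-|\tau| : \omega_i\omega_{i+1}\cdots\omega_{i+|\tau|-1}=\tau\}$ is the frequency of $\tau$ as a (contiguous) subword of $\omega$; if $|\tau|>|\omega|$ then $T(\tau,\omega)=0$. Let $1^{k+1}$ denote the word of $k+1$ consecutive ones. The $(0,k,p)$-RLL semiconstrained system is the set of all finite binary words $\omega$ with $T(1^{k+1},\omega)\leq p$. Let $\mathcal{B}_n=\{\omega\in\{0,1\}^n : T(1^{k+1},\omega)\leq p\}$. Its capacity is $C_{k,p}=\limsup_{n\to\infty}\frac1n\log_2|\mathcal{B}_n|$. *)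

(* Defs.v *)
From mathcomp Require Import all_boot all_order all_algebra.
From mathcomp Require Import all_classical all_reals all_analysis.

Set Implicit Arguments.
Unset Strict Implicit.
Unset Printing Implicit Defensive.

Import Order.TTheory GRing.Theory Num.Theory.
Import numFieldNormedType.Exports.

Local Open Scope ring_scope.

Definition log2 {R : realType} (x : R) : R := ln x / ln 2.

Definition occurrences (tau omega : seq bool) : nat :=
  count (fun i => take (size tau) (drop i omega) == tau)
        (iota 0 (size omega - size tau).+1).

Definition subword_freq (R : realType) (tau omega : seq bool) : R :=
  if (size tau <= size omega)%N
  then (occurrences tau omega)%:R / (size omega - size tau).+1%:R
  else 0.

Definition rll_system (R : realType) (k : nat) (p : R) : {pred seq bool} :=
  [pred omega | subword_freq R (nseq k.+1 true) omega <= p].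

Definition rll_words (R : realType) (k : nat) (p : R) (n : nat) :
    {set n.-tuple bool} :=
  [set omega : n.-tuple bool | tval omega \in rll_system k p].

(* The limit superior is taken in the extended reals; the term at n = 0 is 0
   since 0^-1 = 0, and has no influence on the value. *)
Definition rll_capacity (R : realType) (k : nat) (p : R) : \bar R :=
  limn_esup (fun n => (log2 (#|rll_words k p n|%:R : R) / n%:R)%:E).

(* Main.v *)
Require Import Defs.
From mathcomp Require Import all_boot all_order all_algebra.
From mathcomp Require Import all_classical all_reals all_analysis.
From mathcomp Require Import ring lra zify.

Set Implicit Arguments.
Unset Strict Implicit.
Unset Printing Implicit Defensive.

Import Order.TTheory GRing.Theory Num.Theory.
Import numFieldNormedType.Exports.

Local Open Scope ring_scope.

(* This is Janson's lower-tail inequality for the number X of windows of k+1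
   consecutive ones in a uniform word of length n. Given that a window
   A = [i, i+k] is all ones, X = X(u) + L(u) + 1 + R(v) + X(v), where u and v
   are the parts of the word on either side of A, and L(u), R(v) count the other
   windows meeting A. By Harris' inequality on each side and then Jensen's,
   E[e^{-sX} | A] >= e^{-sD} E[e^{-sX(u)}] E[e^{-sX(v)}] >= e^{-sD} E[e^{-sX}]
   with D = 3 - 2^{1-k} >= 1 + E[L] + E[R]. Summing over A bounds the logarithmic
   derivative of s |-> E[e^{-sX}]; integrating gives
   E[e^{-sX}] <= exp(- (n-k) 2^{-(k+1)} (1 - e^{-sD}) / D),
   and Chernoff's bound at e^{-sD} = p 2^{k+1} gives the rate. *)

(** * Windows of consecutive ones in a word *)

Section RunCount.
Local Open Scope nat_scope.
Implicit Types (d i j : nat) (u v w : seq bool).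

Fixpoint run_count d w : nat :=
  if w is _ :: w' then prefix (nseq d true) w + run_count d w' else 0.

(* The windows of length d that start inside u and end inside a run of
   ones following u. *)
Fixpoint left_overlap d u : nat :=
  if u is _ :: u' then ((size u < d) && all id u) + left_overlap d u' else 0.

(** Mirror image of [left_overlap]: a window that starts in a long run of ones before [v] and ends
    in [v] uses [i] letters of [v], which must all be ones. *)
Definition right_overlap d v : nat :=
  \sum_(1 <= i < d) prefix (nseq i true) v.

Lemma run_count_cons d b w :
  run_count d (b :: w) = prefix (nseq d true) (b :: w) + run_count d w.
Proof. by []. Qed.

Lemma left_overlap_cons d b u :
  left_overlap d (b :: u) =
  ((size (b :: u) < d) && all id (b :: u)) + left_overlap d u.
Proof. by []. Qed.

Lemma prefix_nseqE d w :
  prefix (nseq d true) w = (d <= size w) && all id (take d w).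
Proof. by elim: d w => [|d IH] [|[] w] //=; rewrite ?IH ?andbF. Qed.

Lemma prefix_nseq_cat d j v : j <= d ->
  prefix (nseq d true) (nseq j true ++ v) = prefix (nseq (d - j) true) v.
Proof. by elim: j d => [|j IH] [|d] //= /IH. Qed.

Lemma run_count_sum d w :
  run_count d w = \sum_(0 <= i < size w) prefix (nseq d true) (drop i w).
Proof.
elim: w => [|b w IH]; first by rewrite big_geq.
by rewrite run_count_cons IH [size _]/= big_nat_recl// drop0.
Qed.

Lemma run_count_superadd d u v :
  run_count d u + run_count d v <= run_count d (u ++ v).
Proof.
elim: u => [|b u IH] //.
rewrite cat_cons !run_count_cons -addnA leq_add// -cat_cons.
by case: (boolP (prefix _ (b :: u))) => // /prefix_catl ->.
Qed.

(** The window starting [d - i] letters before [v] still needs [i] ones from [v]; these starts range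
    over the [j] leading ones. *)
Lemma run_count_nseq_cat d j v : j <= d ->
  run_count d (nseq j true ++ v) =
  \sum_(d - j <= i < d) prefix (nseq i true) v + run_count d v.
Proof.
elim: j => [|j IH] jd; first by rewrite subn0 big_geq.
rewrite [nseq _ _ ++ _]/= run_count_cons IH ?(ltnW jd)//.
rewrite -[true :: _]/(nseq j.+1 true ++ v) prefix_nseq_cat// addnA.
by rewrite [in RHS]big_ltn ?ltn_subrL ?(leq_trans _ jd)// subnSK.
Qed.

(** Either [d] ones fit inside [u], or [u] is all ones but too short and the run opening [w]
    supplies the missing letters. *)
Lemma prefix_nseq_catl d u w : prefix (nseq d true) w ->
  prefix (nseq d true) (u ++ w) =
  prefix (nseq d true) u + ((size u < d) && all id u) :> nat.
Proof.
elim: u d => [|b u IH] [|d]; rewrite ?prefix0s ?cat0s ?andbF// => dw.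
  by rewrite dw.
case: b; last by rewrite /= andbF.
rewrite [nseq _ _]/= cat_cons !prefix_cons ?eqxx//= IH//.
apply: prefix_trans dw; elim: d {IH} => //= d IH.
Qed.

Lemma run_count_cat_nseq d u w : prefix (nseq d true) w ->
  run_count d (u ++ w) = run_count d u + left_overlap d u + run_count d w.
Proof.
move=> dw; elim: u => [|b u IH] //.
rewrite cat_cons !run_count_cons IH -cat_cons prefix_nseq_catl//.
by rewrite left_overlap_cons; lia.
Qed.

Lemma run_count_split d u v :
  run_count d.+1 (u ++ nseq d.+1 true ++ v) =
  run_count d.+1 u + left_overlap d.+1 u +
  (1 + right_overlap d.+1 v + run_count d.+1 v).
Proof.
rewrite run_count_cat_nseq ?run_count_nseq_cat ?subnn//.
  (* The term [i = 0] of the sum is the central window itself, which needs nothing from [v]. *)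
  by rewrite big_ltn// prefix0s.
by rewrite prefix_nseq_cat// subnn prefix0s.
Qed.

(** The coordinatewise order with [false] below [true], for which Harris' inequality is used; it
    relates only words of equal length. *)
Definition leword := all2 implb.

Lemma leword_prefix d u v : leword u v ->
  prefix (nseq d true) u <= prefix (nseq d true) v.
Proof.
elim: u v d => [|b u IH] [|c v] [|d] //= /andP[bc /IH uv].
by case: b bc => //= ->; exact: uv.
Qed.

Lemma leword_size u v : leword u v -> size u = size v.
Proof. by rewrite /leword all2E => /andP[/eqP]. Qed.

Lemma leword_all u v : leword u v -> all id u <= all id v.
Proof.
elim: u v => [|b u IH] [|c v] //= /andP[bc /IH].
by case: b bc => //= ->.
Qed.

Lemma leword_run_count d u v : leword u v -> run_count d u <= run_count d v.
Proof.
elim: u v => [|b u IH] [|c v] // uv; rewrite !run_count_cons leq_add ?leword_prefix//.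
by apply: IH; case/andP: uv.
Qed.

Lemma leword_left_overlap d u v :
  leword u v -> left_overlap d u <= left_overlap d v.
Proof.
elim: u v => [|b u IH] [|c v] // uv; rewrite !left_overlap_cons leq_add//; last first.
  by apply: IH; case/andP: uv.
by rewrite (leword_size uv); case: ltnP => // _; exact: leword_all.
Qed.

Lemma leword_right_overlap d u v :
  leword u v -> right_overlap d u <= right_overlap d v.
Proof. by move=> uv; apply: leq_sum => i _; exact: leword_prefix. Qed.

Lemma run_count_nseq_false d n : run_count d.+1 (nseq n false) = 0.
Proof. by elim: n. Qed.

Lemma occurrences_run_count d w :
  occurrences (nseq d.+1 true) w = run_count d.+1 w.
Proof.
rewrite /occurrences run_count_sum size_nseq -sum1_count big_mkcond.
rewrite -[iota 0 _]/(index_iota 0 (size w - d.+1).+1).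
under eq_bigr => i _.
  rewrite -{1}(size_nseq d.+1 true) -prefixE -[if _ then _ else _]/(nat_of_bool _); over.
(* [run_count] tries every start; those that leave no full window contribute nothing. *)
have vanish i : size w - d.+1 < i -> prefix (nseq d.+1 true) (drop i w) = false.
  by move=> wi; rewrite prefix_nseqE size_drop; case: leqP => //; lia.
(* Subtraction is truncated: the first case is the empty word, where [occurrences] still tests the
   start 0. *)
have [wd|dw] := leqP (size w) (size w - d.+1).
  have -> : size w = 0 by lia.
  rewrite sub0n big_nat1 [RHS]big_geq// drop_oversize//; lia.
rewrite (big_cat_nat _ dw)//= [X in _ = _ + X]big_nat_cond.
by rewrite [X in _ = _ + X]big1 ?addn0// => i /andP[/andP[/vanish -> _] _].
Qed.

End RunCount.

(** * Expectation over uniform words; the inequalities of Harris and Jensen *)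

Section Mean.
Variable R : realType.
Implicit Types (f g : seq bool -> R) (n m d : nat) (c : R).

(** Expectation over a uniform word of length [n], built by conditioning on the first letter so that
    inequalities tensorize by induction. *)
Fixpoint mean n f : R :=
  if n is n'.+1 then
    (mean n' (fun w => f (true :: w)) + mean n' (fun w => f (false :: w))) / 2
  else f [::].

Lemma meanS n f :
  mean n.+1 f =
  (mean n (fun w => f (true :: w)) + mean n (fun w => f (false :: w))) / 2.
Proof. by []. Qed.

Lemma meanE n f : mean n f = (\sum_(w : n.-tuple bool) f w) / 2 ^+ n.
Proof.
elim: n f => [|n IH] f /=.
  by rewrite expr0 divr1 (big_pred1 [tuple])// => w; exact/esym/eqP/tuple0.
rewrite !IH -mulrDl exprSr invfM mulrA; congr (_ / _ / _).
rewrite (reindex (fun bw : bool * n.-tuple bool => [tuple of bw.1 :: bw.2])).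
  rewrite -(pair_bigA _ (fun b (w : n.-tuple bool) => f [tuple of b :: w]))/=.
  by rewrite big_bool.
exists (fun w => (thead w, [tuple of behead w])) => [[b w] _|w _] /=.
  by congr pair; apply: val_inj.
by rewrite -tuple_eta.
Qed.

Lemma le_mean n f g : (forall w, size w = n -> f w <= g w) ->
  mean n f <= mean n g.
Proof.
elim: n f g => [|n IH] f g fg /=; first exact: fg.
by rewrite ler_pM2r ?invr_gt0// lerD// IH// => w wn; rewrite fg//= wn.
Qed.

Lemma eq_mean n f g : (forall w, size w = n -> f w = g w) ->
  mean n f = mean n g.
Proof. by move=> fg; apply/eqP; rewrite eq_le !le_mean// => w /fg ->. Qed.

Lemma mean_cst n c : mean n (fun=> c) = c.
Proof. by elim: n => //= n ->; field. Qed.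

Lemma meanZ n c f : mean n (fun w => c * f w) = c * mean n f.
Proof. by elim: n f => //= n IH f; rewrite !IH; field. Qed.

Lemma meanD n f g : mean n (fun w => f w + g w) = mean n f + mean n g.
Proof. by elim: n f g => //= n IH f g; rewrite !IH; field. Qed.

Lemma mean_sum n (I : Type) (r : seq I) (F : I -> seq bool -> R) :
  mean n (fun w => \sum_(i <- r) F i w) = \sum_(i <- r) mean n (F i).
Proof.
elim: r => [|i r IH].
  by rewrite big_nil -[RHS](mean_cst n); apply: eq_mean => w; rewrite big_nil.
rewrite big_cons -IH -meanD.
by apply: eq_mean => w _; rewrite big_cons.
Qed.

Lemma mean_ge0 n f : (forall w, 0 <= f w) -> 0 <= mean n f.
Proof. by move=> f0; rewrite -(mean_cst n 0); apply: le_mean. Qed.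

Lemma mean_cat n m f :
  mean (n + m) f = mean n (fun u => mean m (fun v => f (u ++ v))).
Proof. by elim: n f => //= n IH f; rewrite !IH. Qed.

Lemma mean_prefix d m f :
  mean (d + m) (fun w => (prefix (nseq d true) w)%:R * f w) =
  2 ^- d * mean m (fun v => f (nseq d true ++ v)).
Proof.
elim: d f => [|d IH] f.
  by rewrite invr1 mul1r; apply: eq_mean => w; rewrite prefix0s mul1r.
rewrite addSn /= IH.
rewrite [X in _ + X](_ : _ = 0); first by rewrite exprS; field.
by rewrite -(mean_cst (d + m) 0); apply: eq_mean => w _; rewrite mul0r.
Qed.

Lemma mean_prefix_le n d :
  mean n (fun w => (prefix (nseq d true) w)%:R) <= 2 ^- d.
Proof.
have [dn|nd] := leqP d n.
  have := mean_prefix d (n - d) (fun=> 1); rewrite subnKC// mean_cst mulr1 => <-.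
  by apply: le_mean => w _; rewrite mulr1.
rewrite (@le_trans _ _ 0) ?invr_ge0 ?exprn_ge0// -[leRHS](mean_cst n).
by apply: le_mean => w wn; rewrite prefix_nseqE wn leqNgt nd.
Qed.

(** A suffix of length [j] is all ones with probability [2 ^- j]. Summing over [1 <= j <= minn n d]
    gives an exact value, from which the bound follows. *)
Lemma mean_left_overlap_le n d :
  mean n (fun u => (left_overlap d.+1 u)%:R) <= 1 - 2 ^- d.
Proof.
suff -> : mean n (fun u => (left_overlap d.+1 u)%:R) = 1 - 2 ^- minn n d.
  by rewrite lerD2l lerN2 lef_pV2 ?posrE ?exprn_gt0// ler_weXn2l ?ler1n// geq_minr.
have allid m : mean m (fun w => (all id w)%:R) = 2 ^- m.
  elim: m => [|m IH] /=; first by rewrite invr1.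
  by rewrite IH mean_cst exprS; field.
elim: n => [|n IH]; first by rewrite min0n /= invr1 subrr.
have step b : mean n (fun w => (left_overlap d.+1 (b :: w))%:R) =
    (b && (n < d)%N)%:R * 2 ^- n + (1 - 2 ^- minn n d).
  rewrite -IH -allid -meanZ -meanD; apply: eq_mean => w wn.
  by rewrite left_overlap_cons natrD /= wn ltnS -mulnb natrM; case: b; case: ltnP;
    rewrite ?mul0r ?mul1r.
rewrite meanS !step.
have [nd|dn] := ltnP n d.
  by rewrite (minn_idPl nd) exprS /=; field.
by rewrite (minn_idPr (leqW dn)) /=; lra.
Qed.

Lemma mean_right_overlap_le n d :
  mean n (fun v => (right_overlap d.+1 v)%:R) <= 1 - 2 ^- d.
Proof.
under eq_mean => w _ do rewrite /right_overlap natr_sum.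
rewrite mean_sum (@le_trans _ _ (\sum_(1 <= i < d.+1) 2 ^- i))//.
  by apply: ler_sum => i _; exact: mean_prefix_le.
elim: d => [|d IH]; first by rewrite big_geq// invr1 subrr.
by rewrite big_nat_recr//= (le_trans (lerD IH (lexx _)))// exprS; lra.
Qed.

(** Induction handles each value of the first letter. With f0, f1, g0, g1 the resulting averages,
    the two halves combine by (f0 - f1)(g0 - g1) >= 0, Chebyshev's inequality on two points. *)
Lemma mean_harris n f g :
    (forall u v, leword u v -> f v <= f u) ->
    (forall u v, leword u v -> g v <= g u) ->
  mean n f * mean n g <= mean n (fun w => f w * g w).
Proof.
elim: n f g => //= n IH f g fa ga.
have fa1 b u v : leword u v -> f (b :: v) <= f (b :: u).
  by move=> uv; apply: fa; rewrite /= uv implybb.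
have ga1 b u v : leword u v -> g (b :: v) <= g (b :: u).
  by move=> uv; apply: ga; rewrite /= uv implybb.
have lexx_word w : leword w w by elim: w => //= b w ->; rewrite implybb.
have F : mean n (fun w => f (true :: w)) <= mean n (fun w => f (false :: w)).
  by apply: le_mean => w _; apply: fa => /=.
have G : mean n (fun w => g (true :: w)) <= mean n (fun w => g (false :: w)).
  by apply: le_mean => w _; apply: ga => /=.
have := IH _ _ (fa1 true) (ga1 true).
have := IH _ _ (fa1 false) (ga1 false).
nra.
Qed.

(** Jensen's inequality letter by letter: each step is 2xy <= x^2 + y^2 with x = e^(a/2) and y =
    e^(b/2). *)
Lemma expR_mean n f : expR (mean n f) <= mean n (fun w => expR (f w)).
Proof.
elim: n f => //= n IH f.
have := IH (fun w => f (true :: w)); have := IH (fun w => f (false :: w)).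
set a := mean n (fun w => f (true :: w)); set b := mean n (fun w => f _).
rewrite mulrDl expRD.
have -> : expR a = expR (a / 2) ^+ 2 by rewrite -expRM_natl; congr expR; field.
have -> : expR b = expR (b / 2) ^+ 2 by rewrite -expRM_natl; congr expR; field.
have := sqr_ge0 (expR (a / 2) - expR (b / 2)); nra.
Qed.

Lemma is_derive_mean_expR n f (s : R) :
  is_derive s 1 (fun t => mean n (fun w => expR (- t * f w)))
    (- mean n (fun w => f w * expR (- s * f w))).
Proof.
elim: n f => [|n IH] f /=.
  have h : is_derive s 1 (fun t : R => - t * f [::]) (- f [::]).
    apply: (is_derive_eq (is_deriveM (is_deriveN (is_derive_id s 1))
      (is_derive_cst (f [::]) s 1))).
    by rewrite /GRing.scale/=; ring.
  apply: (is_derive_eq (is_derive1_comp (is_derive_expR _) h)).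
  by rewrite /GRing.scale/=; ring.
have h := is_deriveM (is_deriveD (IH (fun w => f (true :: w)))
  (IH (fun w => f (false :: w)))) (is_derive_cst (2^-1 : R) s 1).
apply: (is_derive_eq h).
by rewrite /GRing.scale/=; ring.
Qed.

End Mean.

(** * Janson's bound on the Laplace transform of the window count *)

Section LowerTail.
Variable R : realType.
Implicit Types (n i m k : nat) (s a : R).

Definition laplace k n s : R := mean n (fun w => expR (- s * (run_count k.+1 w)%:R)).

(** Forgetting the windows that meet the middle block only lowers the count, hence raises the
    exponential; the two outer parts are independent. *)
Lemma laplace_submul k i m s : 0 <= s ->
  laplace k (i + (k.+1 + m)) s <= laplace k i s * laplace k m s.
Proof.
move=> s0; rewrite /laplace mean_cat.
pose e w : R := expR (- s * (run_count k.+1 w)%:R).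
rewrite (@le_trans _ _ (mean i (fun u => mean (k.+1 + m) (fun=> e u * mean m e))))//.
  apply: le_mean => u _; rewrite mean_cat mean_cst.
  rewrite -[leRHS](mean_cst k.+1).
  apply: le_mean => x _; rewrite -meanZ; apply: le_mean => v _.
  rewrite -expRD ler_expR -mulrDr -natrD ler_wnM2l ?oppr_le0// ler_nat.
  rewrite (leq_trans _ (run_count_superadd _ _ _))// leq_add2l.
  by rewrite (leq_trans _ (run_count_superadd _ _ _))// leq_addl.
under eq_mean => u _ do rewrite mean_cst mulrC.
by rewrite meanZ mulrC.
Qed.

(* Harris' inequality followed by Jensen's inequality. *)
Lemma mean_overlap_laplace k n s a (c : seq bool -> nat) : 0 <= s ->
    (forall u v, leword u v -> (c u <= c v)%N) -> mean n (fun w => (c w)%:R) <= a ->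
  expR (- s * a) * laplace k n s <=
  mean n (fun w => expR (- s * (c w)%:R) * expR (- s * (run_count k.+1 w)%:R)).
Proof.
move=> s0 cm ca.
have anti (c' : seq bool -> nat) :
    (forall u v, leword u v -> (c' u <= c' v)%N) ->
    forall u v, leword u v -> expR (- s * (c' v)%:R) <= expR (- s * (c' u)%:R).
  by move=> c'm u v /c'm uv; rewrite ler_expR ler_wnM2l ?oppr_le0// ler_nat.
apply: (le_trans _ (mean_harris n (anti _ cm) (anti _ (@leword_run_count k.+1)))).
rewrite ler_wpM2r//; first by apply: mean_ge0 => w; exact: expR_ge0.
by apply: (le_trans _ (expR_mean _ _)); rewrite meanZ ler_expR ler_wnM2l ?oppr_le0.
Qed.

(* Sum of P(B | A) over the windows B meeting a window A, A included. *)
Definition overlap_mass k : R := 3 - 2 / 2 ^+ k.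

(** Given the window, the two sides are independent and the expectation factors as [L * T]. Each
    side costs a factor at least e^(-s(1 - 2^-k)), and [laplace_submul] rejoins the two remaining
    transforms. *)
Lemma mean_window_laplace k i m s : 0 <= s ->
  2 ^- k.+1 * expR (- s * overlap_mass k) * laplace k (i + (k.+1 + m)) s <=
  mean (i + (k.+1 + m)) (fun w => (prefix (nseq k.+1 true) (drop i w))%:R *
    expR (- s * (run_count k.+1 w)%:R)).
Proof.
move=> s0; rewrite [leRHS]mean_cat.
pose e w : R := expR (- s * (run_count k.+1 w)%:R).
pose L := mean i (fun u => expR (- s * (left_overlap k.+1 u)%:R) * e u).
pose T := mean m (fun v => expR (- s * (right_overlap k.+1 v)%:R) * e v).
suff -> : mean i (fun u => mean (k.+1 + m) (fun v =>
    (prefix (nseq k.+1 true) (drop i (u ++ v)))%:R * e (u ++ v))) =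
    2 ^- k.+1 * expR (- s) * (L * T).
  have -> : - s * overlap_mass k = - s + - s * (1 - 2 ^- k) + - s * (1 - 2 ^- k).
    by rewrite /overlap_mass; ring.
  rewrite 2!expRD !mulrA -!mulrA ler_pM2l ?invr_gt0 ?exprn_gt0//.
  rewrite ler_pM2l ?expR_gt0//.
  apply: (@le_trans _ _ ((expR (- s * (1 - 2 ^- k)) * laplace k i s) *
                         (expR (- s * (1 - 2 ^- k)) * laplace k m s))).
    have := laplace_submul k i m s0.
    rewrite -(ler_pM2l (expR_gt0 (- s * (1 - 2 ^- k)))).
    by rewrite -(ler_pM2l (expR_gt0 (- s * (1 - 2 ^- k)))); lra.
  have l0 n : 0 <= laplace k n s by apply: mean_ge0 => w; exact: expR_ge0.
  rewrite ler_pM ?mulr_ge0 ?expR_ge0//; apply: mean_overlap_laplace => //.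
  - exact: leword_left_overlap.
  - exact: mean_left_overlap_le.
  - exact: leword_right_overlap.
  - exact: mean_right_overlap_le.
transitivity (mean i (fun u => 2 ^- k.+1 * expR (- s) * T *
    (expR (- s * (left_overlap k.+1 u)%:R) * e u))); last by rewrite meanZ -/L; ring.
apply: eq_mean => u ui; rewrite -{1}ui.
under eq_mean => v _ do rewrite drop_size_cat//.
rewrite (mean_prefix _ _ (fun v => e (u ++ v))) -!mulrA; congr (_ * _).
transitivity (expR (- s) * (expR (- s * (left_overlap k.+1 u)%:R) * e u) * T);
  last by ring.
rewrite -meanZ; apply: eq_mean => v _.
by rewrite /e run_count_split -!expRD; congr expR; rewrite !natrD; ring.
Qed.

(** Exactly [n - k] starts leave room for a full window; the one-window bound is summed over
    them. *)
Lemma mean_run_count_laplace k n s : 0 <= s ->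
  (n - k)%N%:R * (2 ^- k.+1 * expR (- s * overlap_mass k)) * laplace k n s <=
  mean n (fun w => (run_count k.+1 w)%:R * expR (- s * (run_count k.+1 w)%:R)).
Proof.
move=> s0.
apply: (@le_trans _ _ (mean n (fun w => \sum_(0 <= i < (n - k)%N)
    (prefix (nseq k.+1 true) (drop i w))%:R * expR (- s * (run_count k.+1 w)%:R)))).
  rewrite mean_sum -[X in X%:R](subn0 (n - k)%N) -sumr_const_nat !mulr_suml.
  rewrite !big_mkord; apply: ler_sum => i _.
  have := mean_window_laplace k i (n - k.+1 - i) s0.
  by rewrite mul1r; have -> : (i + (k.+1 + (n - k.+1 - i)))%N = n
    by have := ltn_ord i; lia.
apply: le_mean => w wn; rewrite -mulr_suml ler_wpM2r ?expR_ge0// -natr_sum ler_nat.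
rewrite [leqRHS]run_count_sum wn.
by rewrite (big_cat_nat _ (leq_subr k n))//= leq_addr.
Qed.

Lemma overlap_mass_gt0 k : 0 < overlap_mass k.
Proof.
have : 2 ^- k <= 1 :> R by rewrite invf_le1 ?exprn_gt0// exprn_ege1 ?ler1n.
by rewrite /overlap_mass; lra.
Qed.

Lemma laplace_le k n s : 0 <= s ->
  laplace k n s <=
  expR (- ((n - k)%N%:R * 2 ^- k.+1 / overlap_mass k *
           (1 - expR (- s * overlap_mass k)))).
Proof.
set D := overlap_mass k; set c := _ / D.
have D0 : 0 < D := overlap_mass_gt0 k.
move=> s0; rewrite expRN -[leRHS]mul1r ler_pdivlMr ?expR_gt0//.
(* The ratio of the transform to the bound sought: it equals 1 at 0, and the previous differential
   inequality makes it nonincreasing. *)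
pose h (t : R) := laplace k n t * expR (c * (1 - expR (- t * D))).
have dh (t : R) : is_derive t 1 h ((c * D * expR (- t * D) * laplace k n t -
    mean n (fun w => (run_count k.+1 w)%:R * expR (- t * (run_count k.+1 w)%:R)))
    * expR (c * (1 - expR (- t * D)))).
  have d1 : is_derive t 1 (fun t : R => - t * D) (- D).
    have d := is_deriveM (is_deriveN (is_derive_id t 1)) (is_derive_cst D t 1).
    by apply: (is_derive_eq d); rewrite /GRing.scale/=; ring.
  have d2 := is_derive1_comp (is_derive_expR _) d1.
  have d3 := is_deriveM (is_derive_cst c t 1)
    (is_deriveB (is_derive_cst (1 : R) t 1) d2).
  have d4 := is_derive1_comp (is_derive_expR _) d3.
  have d5 := is_deriveM (is_derive_mean_expR n (fun w => (run_count k.+1 w)%:R) t) d4.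
  by apply: (is_derive_eq d5); rewrite /GRing.scale/= /laplace; ring.
have h0 : h 0 = 1.
  rewrite /h /laplace oppr0 mul0r expR0 subrr mulr0 expR0 mulr1.
  by under eq_mean => w _ do rewrite mul0r expR0; rewrite mean_cst.
rewrite -[leRHS]h0 -/(h s); apply: (@ler0_derive1_nincry _ h 0) => //.
- move=> t; rewrite in_itv/= andbT => /ltW t0.
  rewrite derive1E; case: (dh t) => _ ->.
  rewrite mulr_le0_ge0 ?expR_ge0// subr_le0.
  apply: le_trans (mean_run_count_laplace k n t0).
  by rewrite -/D /c divfK ?gt_eqF// !mulrA.
- apply: continuous_subspaceT => t; apply: differentiable_continuous.
  by apply/derivable1_diffP; case: (dh t).
Qed.

End LowerTail.

(** * Chernoff's bound and passage to the capacity *)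

Lemma limn_esup_le (R : realType) (u : nat -> \bar R) (a : \bar R) (N : nat) :
  (forall n, (N <= n)%N -> (u n <= a)%E) -> (limn_esup u <= a)%E.
Proof.
move=> ua; pose A := [set n | (N <= n)%N]%classic.
have AN : \oo%classic A by exists N.
apply: (@le_trans _ _ (ereal_sup (u @` A)%classic)).
  by apply: ereal_inf_lbound; exists A.
by apply: ge_ereal_sup => _ [n /ua un <-].
Qed.

Section Capacity.
Variable R : realType.
Implicit Types (n k : nat) (p s : R).

(** The all-zero word is always admissible, so the logarithm of the cardinality is never taken at
    0. *)
Lemma rll_words_gt0 k p n : 0 < p -> (0 < #|rll_words k p n|)%N.
Proof.
move=> p0; apply/card_gt0P; exists [tuple of nseq n false].
rewrite !inE /subword_freq occurrences_run_count run_count_nseq_false mul0r.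
by case: ifP => _; exact: ltW.
Qed.

(** An admissible word has X <= p(n - k) windows of ones, so its indicator is at most e^(s(p(n - k)
    - X)). *)
Lemma card_rll_words_le k p n s : 0 <= s -> (k < n)%N ->
  #|rll_words k p n|%:R <=
  2 ^+ n * (expR (s * (p * (n - k)%N%:R)) * laplace k n s).
Proof.
move=> s0 kn; rewrite -ler_pdivrMl ?exprn_gt0// -meanZ mulrC.
suff -> : #|rll_words k p n|%:R / 2 ^+ n =
    mean n (fun w => (w \in rll_system k p)%:R) :> R.
  apply: le_mean => w wn.
  case: (boolP (w \in _)) => [|_]; last by rewrite mulr_ge0 ?expR_ge0.
  rewrite inE /subword_freq size_nseq wn kn occurrences_run_count -subSn// subSS.
  rewrite ler_pdivrMr ?ltr0n ?subn_gt0// => Xp.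
  rewrite -expRD -[leLHS]expR0 ler_expR mulNr subr_ge0.
  by rewrite ler_wpM2l.
rewrite meanE -sum1_card natr_sum big_mkcond; congr (_ / _).
by apply: eq_bigr => w _; rewrite inE; case: ifP.
Qed.

(** With q = p 2^(k+1) this is 2^-(k+1) (1 - q + q ln q) / ln 2, the Poisson lower-tail rate in base
    2. *)
Definition rate k p : R :=
  log2 (expR 1) / 2 ^+ k.+1 + p * k.+1%:R - p * log2 (expR 1 / p).

Lemma log2_card_rll_words_le k p n : 0 < p -> p <= 1 / 2 ^+ k.+1 -> (k < n)%N ->
  log2 (#|rll_words k p n|%:R : R) <= n%:R - (n - k)%N%:R / overlap_mass R k * rate k p.
Proof.
move=> p0 pk kn; have D0 := overlap_mass_gt0 R k.
have ln2 : 0 < ln 2 :> R by rewrite ln_gt0 ?ltr1n.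
have e0 : 0 < 2 ^+ k.+1 :> R by rewrite exprn_gt0.
(* The ratio of the allowed frequency to the mean frequency 2^-(k+1). *)
set q := p * 2 ^+ k.+1.
have q0 : 0 < q by rewrite mulr_gt0.
have q1 : q <= 1 by rewrite /q -ler_pdivlMr.
have lnq : ln q = ln p + k.+1%:R * ln 2.
  by rewrite lnM ?posrE// lnXn// mulr_natl.
(* The minimizer of the Chernoff exponent: its derivative vanishes when e^(-sD) = q. The bound q <=
   1 makes [s] nonnegative. *)
pose s := - ln q / overlap_mass R k.
have s0 : 0 <= s by rewrite divr_ge0 ?(ltW D0)// oppr_ge0 ln_le0.
have := card_rll_words_le p s0 kn.
move/le_trans/(_ (ler_wpM2l _ (ler_wpM2l (expR_ge0 _) (laplace_le k n s0)))).
rewrite exprn_ge0// => /(_ isT).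
have -> : - s * overlap_mass R k = ln q by rewrite /s; field; rewrite gt_eqF.
rewrite lnK ?posrE// -expRD => h.
rewrite /log2 ler_pdivrMr//.
have := h; rewrite -ler_ln ?posrE ?ltr0n ?rll_words_gt0 ?mulr_gt0 ?exprn_gt0 ?expR_gt0//.
move/le_trans; apply.
rewrite lnM ?posrE ?exprn_gt0 ?expR_gt0// expRK lnXn//.
(* At this [s] the exponent is exactly the claimed one, so only an identity remains. *)
rewrite le_eqVlt; apply/orP; left; apply/eqP.
rewrite /rate /log2 ln_div ?posrE ?expR_gt0// expRK /s lnq /q -[ln 2 *+ n]mulr_natl.
have dn : overlap_mass R k != 0 :> R by rewrite gt_eqF.
have ln2n : ln 2 != 0 :> R by rewrite gt_eqF.
have en : 2 ^+ k.+1 != 0 :> R by rewrite gt_eqF.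
move: dn ln2n en; move: (overlap_mass R k) (ln 2) (2 ^+ k.+1) => D l e dn ln2n en.
by field; rewrite dn ln2n en.
Qed.

End Capacity.

Theorem theorem26 (R : realType) (k : nat) (p : R)
    (hk : (1 <= k)%N) (hp0 : 0 < p) (hp : p <= 1 / 2 ^+ k.+1) :
  (rll_capacity k p <=
    (1 - 1 / (3 - 2 ^ (- k%:Z + 1))
         * (log2 (expR 1) / 2 ^+ k.+1 + p * k.+1%:R
            - p * log2 (expR 1 / p)))%:E)%E.
Proof.
have D0 := overlap_mass_gt0 R k.
set K := rate k p / overlap_mass R k.
rewrite -/(rate k p) (_ : 1 / _ * _ = K); last first.
  by rewrite /K /overlap_mass expfzDr// expr1z -exprnN div1r mulrC [2 / _]mulrC.
apply/lee_addgt0Pr => e e0; rewrite /rll_capacity.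
(* Replacing [n - k] by [n] costs k K / n after division by [n], at most [e] from this rank on; the
   absolute value spares the sign of [K]. *)
pose N := (Num.truncn (k%:R * `|K| / e)).+1.
apply: (@limn_esup_le _ _ _ (maxn N k.+1)) => n.
rewrite geq_max => /andP[Nn kn].
have n0 : 0 < n%:R :> R by rewrite ltr0n (leq_ltn_trans _ kn).
rewrite -EFinD lee_fin ler_pdivrMr//.
apply: (le_trans (log2_card_rll_words_le hp0 hp kn)).
have kK : k%:R * `|K| <= n%:R * e.
  by rewrite -ler_pdivrMr// (le_trans (ltW (truncnS_gt _)))// ler_nat.
have kK' : k%:R * K <= k%:R * `|K| by rewrite ler_wpM2l// ler_norm.
rewrite natrB ?(ltnW kn)// mulrAC -mulrA -/K.
by lra.
Qed.
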